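(* Let $\ell,n\in\mathbb{N}$, let $a_1,\dots,a_{n+1}\in\mathbb{Z}$, let $$g=\operatorname{diag}\left(T^{\frac{a_1}{\ell}},\dots,T^{\frac{a_{n+1}}{\ell}}\right)\in \operatorname{GL}(n+1,\mathcal{K}_{\ell}),$$ and let $g^*=(g^{t})^{-1}$, where $g^t$ is the transpose of $g$. Let $\Lambda$ be a lattice in $\mathcal{K}^{n+1}$ with dual lattice $\Lambda^*$. Then $$q^{-\frac{\ell-1}{\ell}} \leq \lambda_i(g^*\Lambda^* )\,\lambda_{n+2-i}(g\Lambda)\leq q^{\frac{\ell-1}{\ell}}\quad\text{for all } i=1, \dots,n+1.$$
   Context: Let $q$ be a power of a prime, $\mathcal{R}=\mathbb{F}_q[T]$, $\mathcal{K}=\mathbb{F}_q((T^{-1}))$ with absolute value $|a|=q^{\deg a}$. $\mathcal{K}_\ell=\mathcal{K}(T^{1/\ell})$ is the extension obtained by adjoining an $\ell$-th root of $T$, with the extended absolute value ($|T^{1/\ell}|=q^{1/\ell}$); $\mathcal{K}_\ell^{n+1}$ carries the sup norm. A lattice in $\mathcal{K}^{n+1}$ is a set $u\mathcal{R}^{n+1}$ with $u\in\operatorname{GL}(n+1,\mathcal{K})$. Its dual is $\Lambda^*=\{\mathbf{y}\in\mathcal{K}^{n+1}:\langle\mathbf{x},\mathbf{y}\rangle\in\mathcal{R}\ \forall\mathbf{x}\in\Lambda\}$ with $\langle\mathbf{x},\mathbf{y}\rangle=\sum_{i=1}^{n+1}x_iy_i$. For a discrete subgroup $\Gamma\subseteq\mathcal{K}_\ell^{n+1}$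 of the form $h\mathcal{R}^{n+1}$ with $h\in\operatorname{GL}(n+1,\mathcal{K}_\ell)$, the $i$-th successive minimum $\lambda_i(\Gamma)$ is the infimum of $\lambda>0$ such that the ball of radius $\lambda$ centered at the origin of $\mathcal{K}_\ell^{n+1}$ contains $i$ vectors of $\Gamma$ that are linearly independent over $\mathcal{K}_\ell$. *)

(* Defs.v *)
From HB Require Import structures.
From mathcomp Require Import all_boot all_order all_algebra all_field.
From mathcomp Require Import boolp classical_sets fsbigop reals exp.
From mathcomp Require Import zify ring.

Set Implicit Arguments.
Unset Strict Implicit.
Unset Printing Implicit Defensive.

Import Order.TTheory GRing.Theory Num.Theory.
Local Open Scope classical_set_scope.
Local Open Scope ring_scope.

(* [laurent F] is F((T^-1)): the coefficient function k |-> (coefficient of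
   T^k), vanishing for all large k. *)
Record laurent (F : fieldType) := Laurent {
  lcoef :> int -> F;
  lcoef_bounded : exists N : int, forall k, N < k -> lcoef k = 0 }.

HB.instance Definition _ (F : fieldType) := gen_eqMixin (laurent F).
HB.instance Definition _ (F : fieldType) := gen_choiceMixin (laurent F).

Section LaurentField.
Variable F : fieldType.
Implicit Types (f g h : laurent F) (a b : int -> F).

Definition ubounded a (N : int) := forall k, N < k -> a k = 0.

Lemma laurentP f g : (forall k, f k = g k) -> f = g.
Proof.
case: f g => [f fP] [g gP] /= /funext fg; rewrite {}fg in fP *.
by congr Laurent; apply: Prop_irrelevance.
Qed.

Definition ltrunc n a (N : int) : {poly F} := \poly_(i < n) a (N - i%:Z).

(* The support of the summand is finite when [a] and [b] are bounded above. *)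
Definition lconv a b (k : int) : F := \sum_(i \in [set: int]) a i * b (k - i).

Lemma lconv_trunc n a b N M m : ubounded a N -> ubounded b M -> (m < n)%N ->
  lconv a b (N + M - m%:Z) = (ltrunc n a N * ltrunc n b M)`_m.
Proof.
move=> aN bM mn; rewrite /lconv.
pose r := [seq N - i%:Z | i <- index_iota 0 m.+1].
have ur : uniq r.
  by rewrite map_inj_in_uniq ?iota_uniq // => i j _ _ /=; lia.
rewrite (@fsbigE _ _ _ _ _ r) //; last first.
  move=> i _ iNr; have [Ni|iN] := ltP N i; first by rewrite aN ?mul0r.
  rewrite (bM (_ - _)) ?mulr0 //; rewrite ltNge; apply: contra iNr => le_i.
  apply/mapP; exists (absz (N - i)%R); last by lia.
  by rewrite mem_index_iota; lia.
rewrite [LHS](eq_bigl xpredT) => [|i]; last by rewrite in_setT.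
rewrite big_map big_mkord coefM; apply: eq_bigr => i _.
have im : (i <= m)%N by rewrite -ltnS.
have lt_in : (i < n)%N := leq_ltn_trans im mn.
have lt_min : (m - i < n)%N := leq_ltn_trans (leq_subr _ _) mn.
rewrite !coef_poly lt_in lt_min -subzn //; congr (_ * b _).
by ring.
Qed.

Lemma lconv_ubounded a b N M :
  ubounded a N -> ubounded b M -> ubounded (lconv a b) (N + M).
Proof.
move=> aN bM k ltk; rewrite /lconv fsbig1 // => i _.
have [Ni|iN] := ltP N i; first by rewrite aN ?mul0r.
by rewrite (bM (_ - _)) ?mulr0 //; lia.
Qed.

Lemma eq_ubounded a b N : ubounded a N -> ubounded b N ->
  (forall m : nat, a (N - m%:Z) = b (N - m%:Z)) -> a =1 b.
Proof.
move=> aN bN ab k; have [Nk|kN] := ltP N k; first by rewrite aN ?bN.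
by have := ab (absz (N - k)%R); have -> : N - (absz (N - k)%R)%:Z = k by lia.
Qed.

Lemma ltrunc_lconv n a b N M i : ubounded a N -> ubounded b M -> (i < n)%N ->
  (ltrunc n (lconv a b) (N + M))`_i = (ltrunc n a N * ltrunc n b M)`_i.
Proof. by move=> aN bM lt_in; rewrite coef_poly lt_in (lconv_trunc aN bM lt_in). Qed.

Fact lzero_bounded : exists N : int, ubounded (fun=> 0) N.
Proof. by exists 0. Qed.
Definition lzero : laurent F := Laurent lzero_bounded.

Fact lone_bounded : exists N : int, ubounded (fun k => (k == 0)%:R) N.
Proof. by exists 0 => k k0; case: eqP => // kE; rewrite kE ltxx in k0. Qed.
Definition lone : laurent F := Laurent lone_bounded.

Fact lopp_bounded f : exists N, ubounded (fun k => - f k) N.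
Proof. by case: f => f [N fN]; exists N => k /fN /= ->; rewrite oppr0. Qed.
Definition lopp f : laurent F := Laurent (lopp_bounded f).

Fact ladd_bounded f g : exists N, ubounded (fun k => f k + g k) N.
Proof.
case: f g => [f [N fN]] [g [M gM]]; exists (Num.max N M) => k /=.
by rewrite gt_max => /andP[/fN -> /gM ->]; rewrite addr0.
Qed.
Definition ladd f g : laurent F := Laurent (ladd_bounded f g).

Fact lmul_bounded f g : exists N, ubounded (lconv f g) N.
Proof.
case: f g => [f [N fN]] [g [M gM]]; exists (N + M); exact: lconv_ubounded.
Qed.
Definition lmul f g : laurent F := Laurent (lmul_bounded f g).

Fact laddA : associative ladd.
Proof. by move=> f g h; apply: laurentP => k /=; rewrite addrA. Qed.
Fact laddC : commutative ladd.
Proof. by move=> f g; apply: laurentP => k /=; rewrite addrC. Qed.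
Fact ladd0 : left_id lzero ladd.
Proof. by move=> f; apply: laurentP => k /=; rewrite add0r. Qed.
Fact laddN : left_inverse lzero lopp ladd.
Proof. by move=> f; apply: laurentP => k /=; rewrite addNr. Qed.

HB.instance Definition _ := GRing.isZmodule.Build (laurent F)
  laddA laddC ladd0 laddN.

Fact lmulC : commutative lmul.
Proof.
move=> f g; apply: laurentP.
have [N fN] := lcoef_bounded f; have [M gM] := lcoef_bounded g.
have gfNM : ubounded (lmul g f) (N + M) by rewrite addrC; apply: lconv_ubounded.
apply: (eq_ubounded (lconv_ubounded fN gM) gfNM) => m /=.
rewrite (lconv_trunc fN gM (ltnSn m)) addrC [in RHS](addrC N).
by rewrite [(- _ + _)]addrC (lconv_trunc gM fN (ltnSn m)) mulrC.
Qed.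

Fact lmulA : associative lmul.
Proof.
move=> f g h; apply: laurentP.
have [N fN] := lcoef_bounded f; have [M gM] := lcoef_bounded g.
have [P hP] := lcoef_bounded h.
have fgNM := lconv_ubounded fN gM; have ghMP := lconv_ubounded gM hP.
have fghl := lconv_ubounded fN ghMP; have fghr := lconv_ubounded fgNM hP.
rewrite -addrA in fghr.
apply: (eq_ubounded fghl fghr) => m.
rewrite [LHS](lconv_trunc fN ghMP (ltnSn m)) addrA.
rewrite [RHS](lconv_trunc fgNM hP (ltnSn m)).
pose p := ltrunc m.+1 f N; pose q := ltrunc m.+1 g M; pose r := ltrunc m.+1 h P.
transitivity ((p * (q * r))`_m).
  rewrite !coefM; apply: eq_bigr => i _; congr (_ * _).
  by rewrite (ltrunc_lconv gM hP) // ltnS leq_subr.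
rewrite mulrA !coefM; apply: eq_bigr => i _; congr (_ * _).
by rewrite (ltrunc_lconv fN gM).
Qed.

Fact lmul1 : left_id lone lmul.
Proof.
move=> f; apply: laurentP => k /=; rewrite /lconv (@fsbigE _ _ _ _ _ [:: 0]) //.
  by rewrite big_mkcond big_seq1 in_setT /= mul1r subr0.
by move=> i _; rewrite inE => /negPf ->; rewrite mul0r.
Qed.

Fact lmulDl : left_distributive lmul ladd.
Proof.
move=> f g h; apply: laurentP.
have [N0 fN0] := lcoef_bounded f; have [N1 gN1] := lcoef_bounded g.
have [P hP] := lcoef_bounded h.
pose N := Num.max N0 N1.
have fN : ubounded f N by move=> k; rewrite gt_max => /andP[/fN0].
have gN : ubounded g N by move=> k; rewrite gt_max => /andP[_ /gN1].
have fgN : ubounded (ladd f g) N by move=> k Nk /=; rewrite fN ?gN ?addr0.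
have fgh : ubounded (ladd (lmul f h) (lmul g h)) (N + P).
  by move=> k Nk /=; rewrite !(lconv_ubounded _ hP Nk) ?addr0.
apply: (eq_ubounded (lconv_ubounded fgN hP) fgh) => m /=.
rewrite !(lconv_trunc _ hP (ltnSn m)) // -coefD -mulrDl.
suff -> : ltrunc m.+1 (ladd f g) N = ltrunc m.+1 f N + ltrunc m.+1 g N by [].
by apply/polyP => i; rewrite coefD !coef_poly; case: ifP; rewrite ?addr0.
Qed.

Fact lone_neq0 : lone != 0 :> laurent F.
Proof.
apply/eqP => /(congr1 (fun f : laurent F => f 0)) /= /eqP.
by rewrite oner_eq0.
Qed.

HB.instance Definition _ := GRing.Zmodule_isComNzRing.Build (laurent F)
  lmulA lmulC lmul1 lmulDl lone_neq0.

(* The degree; its value at f = 0 is irrelevant. *)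
Definition ldeg f : int := xget 0 [set d | f d != 0 /\ ubounded f d].

Lemma ldegP f : f != 0 -> f (ldeg f) != 0 /\ ubounded f (ldeg f).
Proof.
move=> f_neq0; rewrite /ldeg.
suff : exists d, f d != 0 /\ ubounded f d by case=> d dP; case: xgetP => [?->|/(_ d)].
have [N fN] := lcoef_bounded f.
have [|m fm minm] := @ex_minnP (fun m : nat => f (N - m%:Z) != 0).
  apply: contrapT => noex; case/eqP: f_neq0.
  apply: laurentP; apply: (eq_ubounded fN) => // m /=.
  by apply/eqP; apply: contrapT => /negP fm; apply: noex; exists m.
exists (N - m%:Z); split => // k ltk.
have [/fN //|kN] := ltP N k.
apply/eqP; apply: contraTT ltk => fk.
have := minm (absz (N - k)%R); have -> : N - (absz (N - k)%R)%:Z = k by lia.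
by move=> /(_ fk); lia.
Qed.

Fixpoint linv_seq (c : nat -> F) n : seq F :=
  if n is m.+1 then
    let s := linv_seq c m in
    rcons s ((c 0%N)^-1 * ((m == 0)%N%:R - \sum_(i < m) s`_i * c (m - i)%N))
  else [::].

Lemma lmulV_ex f : f != 0 -> exists g, g * f = 1.
Proof.
move=> /ldegP[]; set d := ldeg f => fd fub.
pose c i := f (d - i%:Z); pose s := linv_seq c.
have ss n : size (s n) = n by elim: n => //= n IH; rewrite size_rcons IH.
have sE n i : (i < n)%N -> (s n)`_i = (s i.+1)`_i.
  elim: n => // n IH; rewrite ltnS leq_eqVlt => /predU1P[-> //|lt_in].
  by rewrite [LHS]nth_rcons ss lt_in IH.
pose b (k : int) := if k <= - d then (s (absz (- d - k)%R).+1)`_(absz (- d - k)%R) else 0.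
have bub : ubounded b (- d) by move=> k; rewrite ltNge /b => /negPf ->.
have bb : exists N, ubounded b N by exists (- d).
exists (Laurent bb); apply: laurentP.
have b1 : ubounded (1 : laurent F) (- d + d).
  by move=> k; rewrite addNr /= => k0; case: eqP => // kE; rewrite kE ltxx in k0.
apply: (eq_ubounded (lconv_ubounded bub fub) b1) => m.
rewrite (lconv_trunc bub fub (ltnSn m)) coefM big_ord_recr /=.
have c0 : c 0%N != 0 by rewrite /c subr0.
have bs i : b (- d - i%:Z) = (s i.+1)`_i.
  rewrite /b ifT; last by lia.
  by have -> : absz (- d - (- d - i%:Z))%R = i by lia.
rewrite !coef_poly ltnSn subnn /= bs -[f _]/(c 0%N) /= nth_rcons ss ltnn eqxx.
rewrite mulrAC mulVf // mul1r addrC (_ : (- d + d - m%:Z == 0) = (m == 0)%N); last by lia.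
rewrite -[X in _ - X + _]/(\sum_(i < m) (s m)`_i * c (m - i)%N).
rewrite -[RHS](subrK (\sum_(i < m) (s m)`_i * c (m - i)%N)); congr (_ + _).
apply: eq_bigr => i _; have lt_im := ltn_ord i.
have lt_i : (i < m.+1)%N := ltnW lt_im.
have lt_mi : (m - i < m.+1)%N by rewrite ltnS leq_subr.
by rewrite !coef_poly lt_i lt_mi bs (sE m i).
Qed.

Definition linv f : laurent F := xget 0 [set g | g * f = 1].

Fact lmulVf f : f != 0 -> linv f * f = 1.
Proof.
by move=> /lmulV_ex[g gf]; rewrite /linv; case: xgetP => [?->|/(_ g)].
Qed.

Fact linv0 : linv 0 = 0.
Proof.
rewrite /linv; case: xgetP => // g _ /=; rewrite mulr0 => /eqP.
by rewrite eq_sym oner_eq0.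
Qed.

HB.instance Definition _ := GRing.ComNzRing_isField.Build (laurent F)
  lmulVf linv0.

Fact lpoly_bounded (p : {poly F}) :
  exists N, ubounded (fun k => if k is Posz n then p`_n else 0) N.
Proof.
by exists (size p)%:Z => -[] // n sp; rewrite nth_default //; apply: ltnW.
Qed.
Definition lpoly (p : {poly F}) : laurent F := Laurent (lpoly_bounded p).

End LaurentField.

Definition labs (R : realType) (F : finFieldType) (f : laurent F) : R :=
  if f == 0 then 0 else #|F|%:R ^ ldeg f.

Section Lattices.
Variables (R : realType) (F : finFieldType) (m : nat).
Local Notation K := (laurent F).

Definition is_lattice (Lam : set 'cV[K]_m) :=
  exists2 u : 'M[K]_m, u \in unitmx &
    Lam = [set u *m map_mx (@lpoly F) v | v in [set: 'cV[{poly F}]_m]].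

Definition dual_lattice (Lam : set 'cV[K]_m) : set 'cV[K]_m :=
  [set y | forall x, Lam x -> range (@lpoly F) (\sum_i x i 0 * y i 0)].

(* K being complete, at most one such N exists on L; when t ^+ l = T in L, it
   satisfies N t = q^(1/l). *)
Definition extends_labs (L : fieldExtType K) (N : L -> R) :=
  [/\ forall x, 0 <= N x,
      forall x, N x = 0 <-> x = 0,
      forall x y, N (x * y) = N x * N y,
      forall x y, N (x + y) <= N x + N y &
      forall c : K, N c%:A = labs R c].

Definition mx_lattice (L : fieldExtType K) (g : 'M[L]_m) (Lam : set 'cV[K]_m) :
    set 'cV[L]_m :=
  [set g *m map_mx (in_alg L) x | x in Lam].

Definition sup_norm (L : fieldType) (N : L -> R) (x : 'cV[L]_m) : R :=
  \big[Num.max/0]_(j < m) N (x j 0).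

Definition succ_min (L : fieldType) (N : L -> R) (Gam : set 'cV[L]_m) (i : nat) : R :=
  inf [set r | 0 < r /\ exists s : i.-tuple 'cV[L]_m,
    free s /\ forall x, x \in tval s -> Gam x /\ sup_norm N x <= r].

End Lattices.

(* Main.v *)
Require Import Defs.
From HB Require Import structures.
From mathcomp Require Import all_boot all_order all_algebra all_field.
From mathcomp Require Import boolp classical_sets fsbigop reals exp.
From mathcomp Require Import zify.

(** The product of the two successive minima is in fact exactly 1.

    Every vector of [g Lam] is [g x] with [x] in [K^(n+1)], so its sup norm is
    the weighted norm [N x = max_j |t|^(a j) |x_j|], an ultrametric norm on
    [K^(n+1)]; likewise the sup norm on [g^* Lam^*] is the dual norm [N*], with
    the inverse weights. The extension of [K] thus enters only through the
    number [|t| = q^(1/l)], and the claim is about a lattice in [K^(n+1)] with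
    two dual norms.

    Choose [b_0, b_1, ...] in [Lam] greedily, each [b_k] of least norm among the
    lattice vectors outside the span of its predecessors. Such a family is
    orthogonal ([reduced_orthogonal]): the norm of a combination is the maximum
    of the norms of its terms. It is also an [F_q[T]]-basis of [Lam]
    ([reduced_integral_coef]). Both facts rest on the division of a scalar
    into a polynomial and a part of absolute value less than 1: the polynomial
    parts keep a vector in the lattice, and the fractional parts contribute a
    vector that is shorter than the minimal one.

    Orthogonality says that the dual basis [b'_k] satisfies [N* b'_k <= 1 / N b_k],
    and the basis property says that it lies in [Lam^*]
    ([lattice_orthogonal_basis]). Then [b_0, ..., b_(n+1-i)] bound the
    [(n+2-i)]-th minimum of [Lam] by [N b_(n+1-i)], and the last [i] dual vectors
    bound the [i]-th minimum of [Lam^*] by its inverse. Conversely, [i]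
    independent vectors of [Lam^*] and [n+2-i] of [Lam] are too many to be
    mutually orthogonal, so some pairing [<x, y>] is a nonzero polynomial and
    [1 <= |<x, y>| <= N x * N* y] ([succ_radii_pairing]). The two bounds meet,
    and 1 lies between the two powers of [q]. *)

Set Implicit Arguments.
Unset Strict Implicit.
Unset Printing Implicit Defensive.

Import Order.TTheory GRing.Theory Num.Theory.
Local Open Scope classical_set_scope.
Local Open Scope ring_scope.

(** * Polynomials and absolute value in the field of Laurent series *)

Section Poly.
Variable F : fieldType.

Lemma lpolyB (p r : {poly F}) : lpoly (p - r) = lpoly p - lpoly r.
Proof. by apply: laurentP => -[k|k] /=; rewrite ?coefB ?subr0. Qed.

Lemma lpolyM (p r : {poly F}) : lpoly (p * r) = lpoly p * lpoly r.
Proof.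
apply: laurentP => -[k|k]; rewrite /= /lconv; last first.
  rewrite fsbig1 // => -[i|i] _ /=; last by rewrite mul0r.
  by have -> : Negz k - i%:Z = Negz (k + i)%N by [lia]; rewrite mulr0.
rewrite coefM (@fsbigE _ _ _ _ _ [seq i%:Z | i <- index_iota 0 k.+1]) //.
- rewrite [RHS](eq_bigl xpredT) => [|i]; last by rewrite in_setT.
  rewrite big_map big_mkord; apply: eq_bigr => i _ /=.
  by rewrite subzn // -ltnS.
- by rewrite map_inj_uniq ?iota_uniq // => i j [].
- move=> [i|i] _ iNr /=; last by rewrite mul0r.
  have ki : (k < i)%N.
    by rewrite ltnNge; apply: contra iNr => ik; rewrite map_f // mem_index_iota.
  have -> : k%:Z - i%:Z = Negz (i - k).-1 by lia.
  by rewrite mulr0.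
Qed.

Lemma lpoly1 : lpoly (1 : {poly F}) = 1.
Proof. by apply: laurentP => -[k|k] //=; rewrite coef1. Qed.

Lemma lpoly_eq0 (p : {poly F}) : (lpoly p == 0) = (p == 0).
Proof.
apply/eqP/eqP => [p0|->]; last by apply: laurentP => -[k|k] //=; rewrite coef0.
apply/polyP => k; rewrite coef0.
exact: (congr1 (fun f : laurent F => f k%:Z) p0).
Qed.

HB.instance Definition _ := GRing.isZmodMorphism.Build _ _ (@lpoly F) lpolyB.
HB.instance Definition _ :=
  GRing.isMonoidMorphism.Build _ _ (@lpoly F) (lpoly1, lpolyM).

End Poly.

Section AbsoluteValue.
Variables (R : realType) (F : finFieldType).
Implicit Types (f g : laurent F) (d : int).
Local Notation q := (#|F|%:R : R).

Lemma card_gt1 : 1 < q.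
Proof. by rewrite ltr1n finNzRing_gt1. Qed.

Let q_gt0 : 0 < q. Proof. exact: lt_trans card_gt1. Qed.

Lemma labs0 : labs R (0 : laurent F) = 0.
Proof. by rewrite /labs eqxx. Qed.

Lemma labs_ge0 f : 0 <= labs R f.
Proof. by rewrite /labs; case: ifP => // _; rewrite exprz_ge0 ?ltW. Qed.

Lemma labs_eq0 f : (labs R f == 0) = (f == 0).
Proof.
by rewrite /labs; case: (eqVneq f 0) => [_|f0]; rewrite ?eqxx // gt_eqF ?exprz_gt0.
Qed.

Lemma labs_le f d : ubounded f d -> labs R f <= q ^ d.
Proof.
move=> fd; rewrite /labs; case: eqVneq => [_|f0]; first by rewrite exprz_ge0 ?ltW.
have [fl _] := ldegP f0; apply: ler_weXz2l; first exact/ltW/card_gt1.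
by rewrite leNgt; apply: contra fl => /fd ->.
Qed.

(** A nonzero coefficient with nothing above it identifies the degree, whatever
    the choice made in [ldeg]. *)
Lemma labs_leading f d : f d != 0 -> ubounded f d -> labs R f = q ^ d.
Proof.
move=> fd0 fd; apply/le_anti; rewrite labs_le //= /labs.
case: eqVneq => [f0|f0]; first by rewrite f0 eqxx in fd0.
have [_ fl] := ldegP f0; apply: ler_weXz2l; first exact/ltW/card_gt1.
by rewrite leNgt; apply: contra fd0 => /fl ->.
Qed.

Lemma labsM f g : labs R (f * g) = labs R f * labs R g.
Proof.
have [->|f0] := eqVneq f 0; first by rewrite mul0r labs0 mul0r.
have [->|g0] := eqVneq g 0; first by rewrite mulr0 labs0 mulr0.
have [fl fb] := ldegP f0; have [gl gb] := ldegP g0.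
rewrite (labs_leading fl fb) (labs_leading gl gb) -expfzDr ?gt_eqF //.
apply: labs_leading; last exact: lconv_ubounded.
rewrite -[X in (f * g) X]subr0 [(f * g) _](lconv_trunc fb gb (ltnSn 0)).
by rewrite coefM big_ord1 !coef_poly /= !subr0 mulf_neq0.
Qed.

Lemma labs1 : labs R (1 : laurent F) = 1.
Proof.
have h : labs R (1 : laurent F) != 0 by rewrite labs_eq0 oner_eq0.
by apply: (mulIf h); rewrite -labsM !mul1r.
Qed.

Lemma labsN f : labs R (- f) = labs R f.
Proof.
have [->|f0] := eqVneq f 0; first by rewrite oppr0.
have [fl fb] := ldegP f0; rewrite (labs_leading fl fb); apply: labs_leading => /=.
  by rewrite oppr_eq0.
by move=> k /fb /= ->; rewrite oppr0.
Qed.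

Lemma labsD f g : labs R (f + g) <= Num.max (labs R f) (labs R g).
Proof.
have [->|f0] := eqVneq f 0; first by rewrite add0r le_max lexx orbT.
have [->|g0] := eqVneq g 0; first by rewrite addr0 le_max lexx.
have [fl fb] := ldegP f0; have [gl gb] := ldegP g0.
rewrite (labs_leading fl fb) (labs_leading gl gb).
have b d : ldeg f <= d -> ldeg g <= d -> labs R (f + g) <= q ^ d.
  move=> fd gd; apply: labs_le => k dk /=.
  by rewrite fb ?gb ?addr0 //; apply: le_lt_trans dk.
rewrite le_max; apply/orP.
by case: (leP (ldeg f) (ldeg g)) => [|/ltW] fg; [right|left]; apply: b.
Qed.

Lemma labs_sum_le (I : Type) (r : seq I) (f : I -> laurent F) (M : R) :
  0 <= M -> (forall i, labs R (f i) <= M) -> labs R (\sum_(i <- r) f i) <= M.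
Proof.
move=> M0 fM; elim/big_rec: _ => [|i x _ xM]; first by rewrite labs0.
by apply: le_trans (labsD _ _) _; rewrite ge_max fM.
Qed.

Lemma labs_lpolyX : labs R (lpoly ('X : {poly F})) = q.
Proof.
rewrite -[RHS]expr1z; apply: labs_leading => [|[k|k] //=].
  by rewrite /= coefX oner_eq0.
by rewrite coefX; case: eqP => // ->.
Qed.

Lemma labs_lpoly_ge1 (p : {poly F}) : p != 0 -> 1 <= labs R (lpoly p).
Proof.
rewrite -lpoly_eq0 /labs => p0; rewrite (negPf p0).
have [pl _] := ldegP p0; rewrite -(expr0z q); apply: ler_weXz2l; first exact/ltW/card_gt1.
by move: pl => /=; case: (ldeg _) => //; rewrite eqxx.
Qed.

Lemma fractional_part f : exists p : {poly F}, labs R (f - lpoly p) < 1.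
Proof.
have [N fN] := lcoef_bounded f.
exists (\poly_(i < (absz N).+1) f i%:Z).
apply: (@le_lt_trans _ _ (q ^ -1%:Z)).
  apply: labs_le => -[k|k] //= _.
  rewrite coef_poly; case: ltnP => [_|Nk]; first by rewrite subrr.
  by rewrite fN ?subr0 //; lia.
by rewrite exprN1 invf_lt1 ?card_gt1.
Qed.

End AbsoluteValue.

(** * Greedy families of lattice vectors *)

Record ultrametric_norm (R : realType) (F : finFieldType)
    (V : lmodType (laurent F)) (N : V -> R) : Prop := UltrametricNorm {
  unorm_ge0 : forall x, 0 <= N x;
  unorm_eq0 : forall x, N x = 0 -> x = 0;
  unormZ : forall c x, N (c *: x) = labs R c * N x;
  unormD : forall x y, N (x + y) <= Num.max (N x) (N y) }.

Section ReducedFamilies.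
Variables (R : realType) (F : finFieldType) (V : vectType (laurent F)).
Variables (N : V -> R) (Lam : set V).
Implicit Types (b : nat -> V) (c : nat -> laurent F).

(** The function-field analogue of a Minkowski-reduced family: the norms of the
    [b k] are the successive minima of [N] on [Lam]. Indexing by [nat] lets the
    family grow one vector at a time without a change of type. *)
Definition reduced b m := forall k, (k < m)%N ->
  [/\ Lam (b k), b k \notin <<mkseq b k>>%VS &
      forall x, Lam x -> x \notin <<mkseq b k>>%VS -> N (b k) <= N x].

Lemma memv_span_mkseq b k x : x \in <<mkseq b k>>%VS ->
  exists c, x = \sum_(i < k) c i *: b i.
Proof.
elim: k x => [|k IH] x.
  rewrite span_nil memv0 => /eqP ->; exists (fun=> 0).
  by rewrite big_ord0.
rewrite mkseqS -cats1 span_cat span_seq1 => /memv_addP[y /IH[c ->] [z /vlineP[a ->] ->]].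
exists (fun i => if (i < k)%N then c i else a).
rewrite big_ord_recr /= ltnn; congr (_ + _).
by apply: eq_bigr => i _; rewrite ltn_ord.
Qed.

Lemma lincomb_span_mkseq b c k : \sum_(i < k) c i *: b i \in <<mkseq b k>>%VS.
Proof.
apply: memv_suml => i _; rewrite memvZ // memv_span //.
by apply/mapP; exists (i : nat); rewrite // mem_iota add0n ltn_ord.
Qed.

Lemma span_mkseqS b i k : (i <= k)%N -> (<<mkseq b i>> <= <<mkseq b k>>)%VS.
Proof.
move=> ik; apply: sub_span => x /mapP[j]; rewrite mem_iota => /= ji ->.
by apply/mapP; exists j; rewrite // mem_iota add0n (leq_trans ji).
Qed.

Hypothesis normN : ultrametric_norm N.

Lemma unorm0 : N 0 = 0.
Proof. by rewrite -(scale0r (0 : V)) (unormZ normN) labs0 mul0r. Qed.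

Lemma unormN x : N (- x) = N x.
Proof. by rewrite -scaleN1r (unormZ normN) labsN labs1 mul1r. Qed.

Lemma unorm_gt0 x : x != 0 -> 0 < N x.
Proof.
by move=> x0; rewrite lt0r unorm_ge0 // andbT; apply: contra x0 => /eqP/unorm_eq0 ->.
Qed.

Lemma unorm_lt x y (M : R) : N x < M -> N y < M -> N (x + y) < M.
Proof. by move=> xM yM; apply: le_lt_trans (unormD normN x y) _; rewrite gt_max xM. Qed.

Lemma unorm_le x y (M : R) : N x <= M -> N y <= M -> N (x + y) <= M.
Proof. by move=> xM yM; apply: le_trans (unormD normN x y) _; rewrite ge_max xM. Qed.

Section Orthogonality.
Variables (b : nat -> V) (m : nat).
Hypothesis LamB : forall x y p, Lam x -> Lam y -> Lam (x - lpoly p *: y).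
Hypothesis bred : reduced b m.

Lemma reduced_gt0 k : (k < m)%N -> 0 < N (b k).
Proof.
move=> /bred[_ bk _]; apply: unorm_gt0.
by apply: contra bk => /eqP ->; rewrite mem0v.
Qed.

Lemma reduced_le i k : (i <= k)%N -> (k < m)%N -> N (b i) <= N (b k).
Proof.
move=> ik km; have [bk bkW _] := bred km.
have [_ _ minb] := bred (leq_ltn_trans ik km).
by apply: minb => //; apply: contra bkW; apply/subvP/span_mkseqS.
Qed.

(** The [N (b i)] increase with [i], so an ultrametric combination with
    coefficients less than 1 in absolute value stays below the last of them. This
    is the source of every contradiction with minimality below. *)
Lemma unorm_fractional_lt c j k : (forall i, labs R (c i) < 1) ->
  (j <= k.+1)%N -> (k < m)%N -> N (\sum_(i < j) c i *: b i) < N (b k).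
Proof.
move=> c1 jk km; elim/big_rec: _ => [|i x _ xk]; first by rewrite unorm0 reduced_gt0.
apply: unorm_lt => //; rewrite (unormZ normN).
have ik : (i <= k)%N by rewrite -ltnS (leq_trans (ltn_ord i)).
apply: lt_le_trans (reduced_le ik km); rewrite gtr_pMl ?c1 //.
exact: reduced_gt0 (leq_ltn_trans ik km).
Qed.

Lemma Lam_sub_lincomb (p : nat -> {poly F}) k x : (k <= m)%N -> Lam x ->
  Lam (x - \sum_(i < k) lpoly (p i) *: b i).
Proof.
elim: k => [|k IH] km Lx; first by rewrite big_ord0 subr0.
rewrite big_ord_recr opprD addrA /=; apply: LamB; first exact: IH (ltnW km) Lx.
by have [] := bred km.
Qed.

(** If [b k + x] were shorter than [b k], then replacing the coefficients of [x] by
    their polynomial parts would change it by a vector shorter than [b k]; the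
    result would be a lattice vector outside the previous span, and shorter than
    the minimal one. *)
Lemma unorm_reduced_shift k x : (k < m)%N -> x \in <<mkseq b k>>%VS ->
  N (b k) <= N (b k + x).
Proof.
move=> km /memv_span_mkseq[c ->]; rewrite leNgt; apply/negP => lt_b.
(* [- c i] is rounded, so that [b k] minus the lattice combination is near [b k + x]. *)
have [p hp] := choice (fun i : nat => fractional_part R (- c i)).
have [Lbk bkW minb] := bred km.
pose y := b k - \sum_(i < k) lpoly (p i) *: b i.
have Ly : Lam y by apply: Lam_sub_lincomb (ltnW km) Lbk.
have yW : y \notin <<mkseq b k>>%VS.
  apply: contra bkW => yW; rewrite -(subrK (\sum_(i < k) lpoly (p i) *: b i) (b k)).
  by rewrite memvD ?(lincomb_span_mkseq _ (fun i => lpoly (p i))).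
have := minb y Ly yW; rewrite leNgt => /negP; apply.
have -> : y = (b k + \sum_(i < k) c i *: b i) + \sum_(i < k) (- c i - lpoly (p i)) *: b i.
  rewrite -addrA -big_split /= /y -sumrN; congr (_ + _); apply: eq_bigr => i _.
  by rewrite scalerBl scaleNr addrA subrr sub0r.
apply: unorm_lt => //.
exact: (unorm_fractional_lt (c := fun i => - c i - lpoly (p i)) hp (leqnSn k) km).
Qed.

Lemma unorm_reduced_last a k x : (k < m)%N -> x \in <<mkseq b k>>%VS ->
  labs R a * N (b k) <= N (x + a *: b k).
Proof.
move=> km xW; have [->|a0] := eqVneq a 0; first by rewrite labs0 mul0r unorm_ge0.
have -> : x + a *: b k = a *: (b k + a^-1 *: x).
  by rewrite scalerDr scalerA divff // scale1r addrC.
by rewrite (unormZ normN) ler_wpM2l ?labs_ge0 ?unorm_reduced_shift ?memvZ.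
Qed.

(** The last term is controlled by [unorm_reduced_last]; it can then be removed
    without raising the norm, which gives the induction. *)
Lemma reduced_orthogonal c j k : (j < k)%N -> (k <= m)%N ->
  labs R (c j) * N (b j) <= N (\sum_(i < k) c i *: b i).
Proof.
elim: k => // k IH; rewrite ltnS leq_eqVlt big_ord_recr /= => jk km.
have := unorm_reduced_last (c k) km (lincomb_span_mkseq b c k).
set x := \sum_(i < k) _ => last_le; case/predU1P: jk => [-> //|jk].
apply: le_trans (IH jk (ltnW km)) _; rewrite -[x in N x](addrK (c k *: b k)) -/x.
by apply: unorm_le; rewrite // unormN (unormZ normN).
Qed.

(** The last nonzero term would place the combination outside the span of the
    preceding vectors, where the minimal norm is [N (b k)]; but a fractional
    combination is shorter. *)
Lemma reduced_fractional_eq0 c j k : (forall i, labs R (c i) < 1) ->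
  (j < k)%N -> (k <= m)%N -> Lam (\sum_(i < k) c i *: b i) -> c j = 0.
Proof.
move=> c1; elim: k => // k IH; rewrite ltnS leq_eqVlt => jk km Lx.
have ck0 : c k = 0.
  have [_ _ minb] := bred km.
  apply/eqP; apply/negPn/negP => ck0.
  have := minb _ Lx; rewrite leNgt (unorm_fractional_lt c1 (leqnn _) km) => /(_ _)/negP.
  case; rewrite // big_ord_recr /=.
  have [_ bkW _] := bred km; apply: contra bkW => xW.
  rewrite -[b k](scalerK ck0) memvZ //.
  rewrite -[_ *: _](addrK (\sum_(i < k) c i *: b i)) addrC memvD //.
    by rewrite memvN lincomb_span_mkseq.
  by rewrite addrC.
case/predU1P: jk => [-> //|jk]; apply: IH => //; first exact: ltnW.
by move: Lx; rewrite big_ord_recr /= ck0 scale0r addr0.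
Qed.

(** Removing the polynomial parts of the coefficients leaves a fractional lattice
    vector, which vanishes: a reduced family generates the lattice over the
    polynomials. *)
Lemma reduced_integral_coef c j k : (j < k)%N -> (k <= m)%N ->
  Lam (\sum_(i < k) c i *: b i) -> exists p, c j = lpoly p.
Proof.
move=> jk km Lx; have [p hp] := choice (fun i : nat => fractional_part R (c i)).
exists (p j); apply/subr0_eq.
apply: (reduced_fractional_eq0 (c := fun i => c i - lpoly (p i)) hp jk km).
rewrite (eq_bigr (fun i : 'I_k => c i *: b i - lpoly (p i) *: b i)).
  by rewrite sumrB; apply: Lam_sub_lincomb.
by move=> i _; rewrite scalerBl.
Qed.

End Orthogonality.

Lemma reduced_exists :
  (forall W : {vspace V}, W != fullv -> exists2 x, Lam x & x \notin W) ->
  (forall S : set V, S `<=` Lam -> ~ S 0 -> S !=set0 ->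
     exists2 x, S x & forall y, S y -> N x <= N y) ->
  exists b, reduced b (\dim {:V}).
Proof.
move=> Lspan Lmin.
suff H m : (m <= \dim {:V})%N -> exists b, reduced b m by exact: H.
elim: m => [|m IH] hm; first by exists (fun=> 0).
have [b bred] := IH (ltnW hm).
pose W := <<mkseq b m>>%VS.
have Wn : W != fullv.
  apply: contraTneq hm => <-; rewrite -leqNgt.
  by apply: leq_trans (dim_span _) _; rewrite size_mkseq.
have [x0 Lx0 x0W] := Lspan W Wn.
have [] := Lmin [set x | Lam x /\ x \notin W].
- by move=> x [].
- by move=> [_]; rewrite mem0v.
- by exists x0.
move=> x [Lx xW] xmin.
pose b' i := if (i < m)%N then b i else x.
have b'W k : (k <= m)%N -> mkseq b' k = mkseq b k.
  move=> km; apply/eq_in_map => i; rewrite mem_iota => /= ik.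
  by rewrite /b' (leq_trans ik).
exists b' => k; rewrite ltnS => km; rewrite b'W // /b'.
case: ltnP => [/bred //|mk].
have -> : k = m by apply/eqP; rewrite eqn_leq km.
by split=> // y Ly yW; apply: xmin.
Qed.

End ReducedFamilies.

(** * Linear algebra over a field *)

Section LinearAlgebra.
Variable (K : fieldType).

Lemma row_free_tuple m k (s : k.-tuple 'cV[K]_m) :
  free s -> row_free (\matrix_(a < k, j < m) (tnth s a) j 0).
Proof.
move=> /freeP sfree; rewrite -kermx_eq0; apply/rowV0P => v /sub_kermxP vM.
apply/rowP => a; rewrite mxE.
apply: (sfree (fun a => v 0 a)); apply/colP => j.
have := congr1 (fun M : 'rV_m => M 0 j) vM; rewrite !mxE summxE => h.
rewrite -[RHS]h; apply: eq_bigr => i _.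
by rewrite !mxE (tnth_nth 0).
Qed.

(** Two mutually orthogonal subspaces of [K^m] have dimensions of sum at most [m]. *)
Lemma free_pairing m i k (X : i.-tuple 'cV[K]_m) (Y : k.-tuple 'cV[K]_m) :
  free X -> free Y -> (m < i + k)%N ->
  exists x y, [/\ x \in tval X, y \in tval Y & \sum_j x j 0 * y j 0 != 0].
Proof.
move=> /row_free_tuple freeX /row_free_tuple freeY ltm.
apply: contrapT => none.
have /mulmx0_rank_max : (\matrix_(a < i, j < m) (tnth X a) j 0) *m
    (\matrix_(a < k, j < m) (tnth Y a) j 0)^T = 0.
  apply/matrixP => a c.
  have [xy0|xy0] := eqVneq (\sum_j (tnth X a) j 0 * (tnth Y c) j 0) 0.
    by rewrite !mxE -[RHS]xy0; apply: eq_bigr => j _; rewrite !mxE.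
  by case: none; exists (tnth X a), (tnth Y c); rewrite !mem_tnth.
by rewrite mxrank_tr (eqP freeX) (eqP freeY) leqNgt ltm.
Qed.

Lemma unitmx_inj m (A : 'M[K]_m) :
  (forall x : 'cV_m, A *m x = 0 -> x = 0) -> A \in unitmx.
Proof.
move=> injA; rewrite -unitmx_tr -row_free_unit -kermx_eq0.
apply/rowV0P => v /sub_kermxP vA; apply: (can_inj trmxK); rewrite trmx0.
by apply: injA; apply: (can_inj trmxK); rewrite trmx_mul trmxK vA trmx0.
Qed.

Lemma mul_mx_colE m (A : 'M[K]_m) (c : 'cV[K]_m) :
  A *m c = \sum_j c j 0 *: col j A.
Proof.
apply/colP => i; rewrite mxE summxE; apply: eq_bigr => j _.
by rewrite !mxE mulrC.
Qed.

Lemma free_cols m k (A : 'M[K]_m) (f : 'I_k -> 'I_m) :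
  A \in unitmx -> injective f -> free [tuple col (f j) A | j < k].
Proof.
move=> Au injf; apply/freeP => c c0 i.
have : A *m (\sum_j c j *: delta_mx (f j) 0) = 0 :> 'cV_m.
  rewrite -[RHS]c0 mulmx_sumr; apply: eq_bigr => j _.
  rewrite -scalemxAr -colE (nth_map i) ?size_enum_ord //.
  by rewrite nth_ord_enum.
move/(congr1 (mulmx (invmx A))); rewrite mulKmx // mulmx0.
move/colP/(_ (f i)); rewrite summxE (bigD1 i) //= !mxE !eqxx mulr1 big1 ?addr0 //.
by move=> j ji; rewrite !mxE (inj_eq injf) eq_sym (negPf ji) mulr0.
Qed.

End LinearAlgebra.

(** * Weighted sup norms *)

Section WeightedNorm.
Variables (R : realType) (F : finFieldType) (m : nat).
Local Notation K := (laurent F).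
Implicit Types (w : 'I_m -> R) (x y : 'cV[K]_m).

Definition wnorm w x : R := \big[Num.max/0]_j (w j * labs R (x j 0)).

Lemma wnorm_ub w x j : w j * labs R (x j 0) <= wnorm w x.
Proof. exact: (le_bigmax _ (fun j => w j * labs R (x j 0)) j). Qed.

Lemma wnorm_le w x M : 0 <= M -> (forall j, w j * labs R (x j 0) <= M) ->
  wnorm w x <= M.
Proof. by move=> M0 xM; apply: bigmax_le. Qed.

Lemma wnorm_ge0 w x : 0 <= wnorm w x.
Proof. exact: bigmax_ge_id. Qed.

Variable w : 'I_m -> R.
Hypothesis w_gt0 : forall j, 0 < w j.

Lemma wnorm_attained x : (0 < m)%N -> exists j, wnorm w x = w j * labs R (x j 0).
Proof.
move=> m0; pose j0 := Ordinal m0.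
have [//|i _|j _ jE] := @Order.TotalTheory.eq_bigmax _ _ _ 0 j0 xpredT
  (fun j => w j * labs R (x j 0)).
  by rewrite mulr_ge0 ?labs_ge0 // ltW.
by exists j; exact: jE.
Qed.

Lemma wnorm_ultrametric : ultrametric_norm (wnorm w).
Proof.
split=> [x|x x0|c x|x y]; first exact: wnorm_ge0.
- apply/colP => j; rewrite mxE; apply/eqP; rewrite -(labs_eq0 R).
  have := wnorm_ub w x j; rewrite x0 => le0.
  by rewrite eq_le labs_ge0 andbT -(ler_pM2l (w_gt0 j)) mulr0.
- rewrite /wnorm; under eq_bigr => j _ do rewrite mxE labsM mulrCA.
  elim/big_rec2: _ => [|j y1 y2 _ ->]; first by rewrite mulr0.
  by rewrite -maxr_pMr ?labs_ge0.
apply: wnorm_le => [|j]; first by rewrite le_max wnorm_ge0.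
rewrite mxE; apply: le_trans (ler_wpM2l (ltW (w_gt0 j)) (labsD _ _ _)) _.
rewrite maxr_pMr; last exact: ltW.
by rewrite ge_max !le_max !wnorm_ub /= orbT.
Qed.

Lemma wnorm_pairing x y :
  labs R (\sum_j x j 0 * y j 0) <= wnorm w x * wnorm (fun j => (w j)^-1) y.
Proof.
apply: labs_sum_le => [|j]; first by rewrite mulr_ge0 ?wnorm_ge0.
have -> : labs R (x j 0 * y j 0) = w j * labs R (x j 0) * ((w j)^-1 * labs R (y j 0)).
  by rewrite labsM mulrACA divff ?mul1r // gt_eqF.
by apply: ler_pM; rewrite ?mulr_ge0 ?invr_ge0 ?labs_ge0 ?wnorm_ub ?ltW.
Qed.

End WeightedNorm.

(** * Orthogonal bases of lattices *)

Section Lattice.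
Variables (R : realType) (F : finFieldType) (n : nat).
Local Notation K := (laurent F).
Local Notation q := (#|F|%:R : R).
Variables (Lam : set 'cV[K]_n.+1) (latLam : is_lattice Lam).

Lemma lattice_subZ x y p : Lam x -> Lam y -> Lam (x - lpoly p *: y).
Proof.
case: latLam => u _ -> [v _ <-] [v' _ <-]; exists (v - p *: v') => //.
by rewrite map_mxB map_mxZ mulmxBr scalemxAr.
Qed.

Lemma lattice_spans (W : {vspace 'cV[K]_n.+1}) :
  W != fullv -> exists2 x, Lam x & x \notin W.
Proof.
case: latLam => u uU -> Wn; apply: contrapT => none; case/eqP: Wn.
apply/eqP; rewrite eqEsubv subvf /=; apply/subvP => x _.
rewrite -(mulKVmx uU x) mul_mx_colE; apply: memv_suml => j _; rewrite memvZ //.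
apply: contrapT => /negP jW; apply: none; exists (col j u) => //.
exists (delta_mx j 0) => //.
by rewrite colE; congr (_ *m _); apply/matrixP => i k; rewrite !mxE rmorph_nat.
Qed.

Section Minimum.
Variables (s : R) (l : nat) (a : 'I_n.+1 -> int).
Hypotheses (s_gt1 : 1 < s) (sX : s ^+ l = q).
Let w j := s ^ a j.

Let s_gt0 : 0 < s. Proof. exact: lt_trans s_gt1. Qed.
Let w_gt0 j : 0 < w j. Proof. exact: exprz_gt0. Qed.

(** The coordinates of [x] in a basis of the lattice are polynomials, and a nonzero
    one has absolute value at least 1; they are bounded by a multiple of the norm
    of [x]. *)
Lemma lattice_norm_ge : exists2 C : R, 0 < C &
  forall x, Lam x -> x != 0 -> C <= wnorm w x.
Proof.
case: latLam => u uU ->.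
pose D := \sum_j \sum_i labs R (invmx u j i) * (w i)^-1.
have term_ge0 j i : 0 <= labs R (invmx u j i) * (w i)^-1.
  by rewrite mulr_ge0 ?labs_ge0 // invr_ge0 ltW.
have D_ge0 : 0 <= D by apply: sumr_ge0 => j _; apply: sumr_ge0.
(* The added 1 makes the constant visibly positive. *)
exists (D + 1)^-1 => [|x [v _ xE] x0]; first by rewrite invr_gt0 ltr_wpDl.
have [j vj] : exists j, v j 0 != 0.
  apply: contrapT => none; case/eqP: x0; rewrite -xE.
  have -> : v = 0.
    apply/colP => j; rewrite mxE; apply/eqP; apply: contrapT => /negP h.
    by apply: none; exists j.
  by rewrite map_mx0 mulmx0.
rewrite -[leLHS]mul1r ler_pdivrMr ?ltr_wpDl //.
apply: le_trans (labs_lpoly_ge1 R vj) _.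
have -> : lpoly (v j 0) = \sum_i invmx u j i * x i 0.
  by have := congr1 (fun y : 'cV_n.+1 => (invmx u *m y) j 0) xE; rewrite mulKmx // !mxE.
apply: labs_sum_le => [|i]; first by rewrite mulr_ge0 ?wnorm_ge0 // ltW ?ltr_wpDl.
rewrite labsM; apply: (@le_trans _ _ (wnorm w x * (labs R (invmx u j i) * (w i)^-1))).
  rewrite mulrCA ler_wpM2l ?labs_ge0 // ler_pdivlMr // mulrC.
  exact: wnorm_ub.
rewrite ler_wpM2l ?wnorm_ge0 // /D (bigD1 j) //= (bigD1 i) //=.
rewrite -!addrA lerDl !addr_ge0 ?sumr_ge0 // => k _.
by rewrite sumr_ge0.
Qed.

(** The nonzero values of the norm are integral powers of [s], because the
    absolute values on [K] are powers of [q = s ^ l]. *)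
Lemma wnorm_gap (x y : 'cV[K]_n.+1) : wnorm w x < wnorm w y -> s * wnorm w x <= wnorm w y.
Proof.
have valE (z : 'cV[K]_n.+1) : z != 0 -> exists e, wnorm w z = s ^ e.
  move=> z0; have [j jE] := wnorm_attained w_gt0 z (ltn0Sn n).
  have := unorm_gt0 (wnorm_ultrametric F w_gt0) z0.
  rewrite jE => /gt_eqF; rewrite mulf_eq0 labs_eq0 => /norP[_ zj0].
  exists (a j + l%:Z * ldeg (z j 0)).
  by rewrite /labs (negPf zj0) expfzDr ?gt_eqF // -sX exprnP -exprz_exp.
have [->|x0] := eqVneq x 0.
  by rewrite (unorm0 (wnorm_ultrametric F w_gt0)) mulr0 wnorm_ge0.
have [->|y0] := eqVneq y 0.
  by rewrite (unorm0 (wnorm_ultrametric F w_gt0)) ltNge wnorm_ge0.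
have [e ->] := valE x x0; have [d ->] := valE y y0.
rewrite ltr_eXz2l // => ed; rewrite -{1}(expr1z s) -expfzDr ?gt_eqF // ler_eXz2l //.
by lia.
Qed.

(** The infimum of the norms is positive, and by [wnorm_gap] a vector with norm below
    [s] times the infimum cannot be improved. *)
Lemma lattice_min (S : set 'cV[K]_n.+1) : S `<=` Lam -> ~ S 0 -> S !=set0 ->
  exists2 x, S x & forall y, S y -> wnorm w x <= wnorm w y.
Proof.
move=> SL S0 [x0 Sx0]; have [C C_gt0 Cle] := lattice_norm_ge.
pose A := [set wnorm w x | x in S].
have CA : lbound A C.
  move=> _ [x Sx <-]; apply: Cle; first exact: SL.
  by apply/eqP => x_eq0; apply: S0; rewrite -x_eq0.
have infA : has_inf A by split; [exists (wnorm w x0), x0 | exists C].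
have inf_gt0 : 0 < inf A by apply: lt_le_trans C_gt0 (lb_le_inf _ CA); case: infA.
have [_ [x Sx <-] lt_x] : exists2 r, A r & r < s * inf A.
  have e_gt0 : 0 < s * inf A - inf A by rewrite subr_gt0 ltr_pMl.
  by have [r Ar] := inf_adherent e_gt0 infA; rewrite addrC subrK; exists r.
exists x => // y Sy; rewrite leNgt; apply/negP => /wnorm_gap le_x.
have := lt_le_trans (le_lt_trans le_x lt_x) (lexx _).
rewrite ltr_pM2l // ltNge => /negP; apply; apply: ge_inf; first by case: infA.
by exists y.
Qed.

(** The columns of [(invmx B)^T] are the dual basis of the columns of [B], so their
    pairings with [x] are the coordinates of [x] in the basis [B]. These are
    polynomials for [x] in the lattice; for the [i]-th standard vector,
    orthogonality bounds the [j]-th one by [w i] over the norm of [col j B],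
    which is the bound on the dual norm. *)
Lemma lattice_orthogonal_basis : exists B : 'M[K]_n.+1,
  [/\ B \in unitmx,
      forall j, Lam (col j B) /\ dual_lattice Lam (col j (invmx B)^T),
      forall j, 0 < wnorm w (col j B),
      forall i j : 'I_n.+1, (i <= j)%N -> wnorm w (col i B) <= wnorm w (col j B) &
      forall j, wnorm (fun i => (w i)^-1) (col j (invmx B)^T) <= (wnorm w (col j B))^-1].
Proof.
have normw := wnorm_ultrametric F w_gt0.
have [b] := reduced_exists lattice_spans lattice_min.
rewrite dimvf /dim /= muln1 => bred.
pose B : 'M[K]_n.+1 := \matrix_(i, j) b j i 0.
have colB j : col j B = b j by apply/colP => i; rewrite !mxE.
have mulB (c : 'cV[K]_n.+1) : B *m c = \sum_(i < n.+1) (c (inord i) 0) *: b i.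
  by rewrite mul_mx_colE; apply: eq_bigr => j _; rewrite colB inord_val.
have orthB (c : 'cV[K]_n.+1) j : labs R (c j 0) * wnorm w (b j) <= wnorm w (B *m c).
  rewrite mulB.
  have := reduced_orthogonal normw lattice_subZ bred (fun i => c (inord i) 0)
    (ltn_ord j) (leqnn _).
  by rewrite inord_val.
have b_gt0 (j : 'I_n.+1) : 0 < wnorm w (b j) := reduced_gt0 normw bred (ltn_ord j).
have uB : B \in unitmx.
  apply: unitmx_inj => c Bc; apply/colP => j; rewrite mxE; apply/eqP.
  rewrite -(labs_eq0 R) eq_le labs_ge0 andbT.
  have := orthB c j; rewrite Bc (unorm0 normw).
  by rewrite pmulr_lle0.
exists B; split=> // [j|j|i j ij|j]; rewrite ?colB //.
- split; first by have [] := bred j (ltn_ord j).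
  move=> x Lx; have [] := reduced_integral_coef normw lattice_subZ bred
    (c := fun i => (invmx B *m x) (inord i) 0) (ltn_ord j) (leqnn _).
    by rewrite -mulB mulKVmx.
  move=> p; rewrite inord_val => pE; exists p => //; rewrite -pE mxE.
  by apply: eq_bigr => i _; rewrite !mxE mulrC.
- exact: (reduced_le bred ij (ltn_ord j)).
apply: wnorm_le => [|i]; first by rewrite invr_ge0 ltW.
(* The entry of [invmx B] at [(j, i)] is a coordinate of the [i]-th standard vector. *)
rewrite !mxE ler_pdivrMl // ler_pdivlMr //.
have := orthB (invmx B *m delta_mx i 0) j; rewrite mulKVmx //.
rewrite -colE mxE => /le_trans; apply.
apply: wnorm_le => [|k]; first exact: ltW.
rewrite mxE eqxx andbT; case: eqVneq => [->|_]; first by rewrite labs1 mulr1.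
by rewrite labs0 mulr0 ltW.
Qed.

End Minimum.

End Lattice.

(** * Duality of successive minima *)

Lemma inf_min (R : realType) (S : set R) (r : R) : S r -> lbound S r -> inf S = r.
Proof.
move=> Sr lbr; apply/le_anti/andP; split; first by apply: ge_inf => //; exists r.
by apply: lb_le_inf => //; exists r.
Qed.

Section Extension.
Variables (R : realType) (F : finFieldType) (L : fieldExtType (laurent F)).
Variables (absL : L -> R) (habs : extends_labs absL).
Local Notation K := (laurent F).
Local Notation q := (#|F|%:R : R).

Lemma absL_alg (c : K) : absL c%:A = labs R c.
Proof. by case: habs. Qed.

Lemma absLM x y : absL (x * y) = absL x * absL y.
Proof. by case: habs. Qed.

Lemma absL1 : absL 1 = 1.
Proof. by rewrite -[1 in LHS]scale1r absL_alg labs1. Qed.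

Lemma absL_gt0 x : x != 0 -> 0 < absL x.
Proof.
case: habs => ge0 eq0 _ _ _ x0; rewrite lt0r ge0 andbT.
by apply: contra x0 => /eqP/eq0 ->.
Qed.

Lemma absLX x k : absL (x ^+ k) = absL x ^+ k.
Proof. by elim: k => [|k IH]; rewrite ?absL1 // !exprS absLM IH. Qed.

Lemma absLXz x (z : int) : x != 0 -> absL (x ^ z) = absL x ^ z.
Proof.
case: z => k x0; first exact: absLX.
have y0 : x ^+ k.+1 != 0 by rewrite expf_neq0.
rewrite NegzE -!exprnN -absLX; apply: (mulfI (lt0r_neq0 (absL_gt0 y0))).
by rewrite -absLM !divff ?absL1 // gt_eqF ?absL_gt0.
Qed.

Variables (t : L) (l : nat).
Hypothesis (ht : t ^+ l = (lpoly ('X : {poly F}))%:A).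

Lemma absL_rootX : absL t ^+ l = q.
Proof. by rewrite -absLX ht absL_alg labs_lpolyX. Qed.

Lemma absL_root_gt1 : 1 < absL t.
Proof.
have [ge0 _ _ _ _] := habs.
rewrite ltNge; apply/negP => t_le1; have := card_gt1 R F.
by rewrite -absL_rootX ltNge exprn_ile1.
Qed.

Lemma root_neq0 : t != 0.
Proof.
apply: contraTneq absL_root_gt1 => ->; have [_ eq0 _ _ _] := habs.
by rewrite (eq0 0).2 // ltNge ler01.
Qed.

Section Diagonal.
Variables (m : nat) (a : 'I_m -> int).
Let g : 'M[L]_m := diag_mx (\row_j t ^ a j).

Lemma mul_diag_map (x : 'cV[K]_m) j :
  (g *m map_mx (in_alg L) x) j 0 = t ^ a j * (x j 0)%:A.
Proof. by rewrite mul_diag_mx !mxE. Qed.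

Lemma sup_norm_diag (x : 'cV[K]_m) :
  sup_norm absL (g *m map_mx (in_alg L) x) = wnorm (fun j => absL t ^ a j) x.
Proof.
apply: eq_bigr => j _.
by rewrite mul_diag_map absLM absLXz ?root_neq0 // absL_alg.
Qed.

Lemma diag_mul_inv : g *m diag_mx (\row_j t ^ (- a j)) = 1%:M.
Proof.
rewrite mulmx_diag -diag_const_mx; congr diag_mx; apply/rowP => j; rewrite !mxE.
by rewrite -expfzDr ?root_neq0 // subrr.
Qed.

Lemma diag_unitmx : g \in unitmx.
Proof. by have [] := mulmx1_unit diag_mul_inv. Qed.

Lemma invmx_trdiag : invmx g^T = diag_mx (\row_j t ^ (- a j)).
Proof. by rewrite tr_diag_mx -[LHS]mulmx1 -diag_mul_inv mulKmx ?diag_unitmx. Qed.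

End Diagonal.

(** [succ_min absL Gam i] is the infimum of this set. *)
Definition succ_radii m (Gam : set 'cV[L]_m) (i : nat) : set R :=
  [set r | 0 < r /\ exists s : i.-tuple 'cV[L]_m,
    free s /\ forall x, x \in tval s -> Gam x /\ sup_norm absL x <= r].

Lemma succ_radii_cols m (a : 'I_m -> int) (Lam : set 'cV[K]_m) (B : 'M[K]_m)
    k (f : 'I_k -> 'I_m) (r : R) :
  B \in unitmx -> injective f -> 0 < r -> (forall j, Lam (col (f j) B)) ->
  (forall j, wnorm (fun i => absL t ^ a i) (col (f j) B) <= r) ->
  succ_radii (mx_lattice (diag_mx (\row_j t ^ a j)) Lam) k r.
Proof.
move=> uB injf r_gt0 LB Br; split=> //.
pose g := diag_mx (\row_j t ^ a j).
exists [tuple col (f j) (g *m map_mx (in_alg L) B) | j < k]; split.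
  by apply: free_cols; rewrite // unitmx_mul diag_unitmx map_unitmx.
move=> _ /mapP[j _ ->]; rewrite colE -mulmxA -colE -map_col.
split; last by rewrite sup_norm_diag.
by exists (col (f j) B).
Qed.

(** The diagonal matrix and its inverse transpose cancel in the pairing, so it
    descends to the pairing of [Lam] with its dual, which takes polynomial
    values. *)
Lemma succ_radii_pairing m (a : 'I_m -> int) (Lam : set 'cV[K]_m) i k r r' :
  (m < i + k)%N ->
  succ_radii (mx_lattice (diag_mx (\row_j t ^ a j)) Lam) i r ->
  succ_radii (mx_lattice (diag_mx (\row_j t ^ (- a j))) (dual_lattice Lam)) k r' ->
  1 <= r * r'.
Proof.
move=> mik [r_gt0 [X [freeX XP]]] [r'_gt0 [Y [freeY YP]]].
have [_ [_ [/XP[[x Lx <-] xr] /YP[[y Ly <-] yr] xy]]] := free_pairing freeX freeY mik.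
rewrite !sup_norm_diag in xr yr.
have s_gt0 : 0 < absL t := absL_gt0 root_neq0.
have [p _ pE] := Ly x Lx.
have p0 : p != 0.
  apply: contra xy => /eqP p0.
  have xy0 : \sum_j x j 0 * y j 0 = 0 by rewrite -pE p0 rmorph0.
  rewrite (eq_bigr (fun j => (x j 0 * y j 0)%:A)) => [|j _].
    by rewrite -scaler_suml xy0 scale0r.
  rewrite !mul_diag_map mulrACA -expfzDr ?root_neq0 // subrr expr0z mul1r.
  exact/esym/(rmorphM (in_alg L)).
apply: le_trans (labs_lpoly_ge1 R p0) _; rewrite pE.
apply: le_trans (wnorm_pairing (w := fun j => absL t ^ a j) _ x y) _ => [j|].
  exact: exprz_gt0.
apply: ler_pM; rewrite ?wnorm_ge0 //; apply: le_trans yr.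
rewrite le_eqVlt; apply/orP; left; apply/eqP; apply: eq_bigr => j _.
by rewrite invr_expz.
Qed.

(** Both infima are attained, at the norm of the vector of index [n.+1 - i] (from
    0) of an orthogonal basis and at its inverse: each of the two radii bounds
    the other set from below by [succ_radii_pairing]. *)
Lemma succ_min_dual n (a : 'I_n.+1 -> int) (Lam : set 'cV[K]_n.+1) i :
  is_lattice Lam -> (1 <= i <= n.+1)%N ->
  let g := diag_mx (\row_j t ^ a j) in
  succ_min absL (mx_lattice (invmx g^T) (dual_lattice Lam)) i *
  succ_min absL (mx_lattice g Lam) (n.+2 - i) = 1.
Proof.
move=> latLam /andP[i_gt0 i_le] g; rewrite /g invmx_trdiag.
have [B [uB LB B_gt0 B_le BV]] :=
  lattice_orthogonal_basis latLam a absL_root_gt1 absL_rootX.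
have k_lt : (n.+1 - i < n.+1)%N by lia.
pose k := Ordinal k_lt.
set w := fun j => absL t ^ a j in B_gt0 B_le BV.
pose r := wnorm w (col k B).
have r_gt0 : 0 < r by exact: B_gt0.
have rP : succ_radii (mx_lattice (diag_mx (\row_j t ^ a j)) Lam) (n.+2 - i) r.
  have le_k : (n.+2 - i <= n.+1)%N by lia.
  apply: (@succ_radii_cols _ _ _ B _ (widen_ord le_k)) => // [|j|j].
  - by move=> j j' /(congr1 val) /= /val_inj.
  - by case: (LB (widen_ord le_k j)).
  - by apply: B_le => /=; have := ltn_ord j; lia.
have r'P : succ_radii (mx_lattice (diag_mx (\row_j t ^ (- a j))) (dual_lattice Lam)) i r^-1.
  (* The dual norms decrease with the index, so the last [i] are the shortest. *)
  have lt_k (j : 'I_i) : (n.+1 - i + j < n.+1)%N by have := ltn_ord j; lia.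
  apply: (@succ_radii_cols _ _ _ (invmx B)^T _ (fun j => Ordinal (lt_k j))).
  - by rewrite unitmx_tr unitmx_inv.
  - by move=> j j' /(congr1 val) /= /addnI /val_inj.
  - by rewrite invr_gt0.
  - by move=> j; case: (LB (Ordinal (lt_k j))).
  move=> j; have := BV (Ordinal (lt_k j)).
  rewrite (_ : (fun i => (w i)^-1) = (fun i => absL t ^ (- a i))); last first.
    by apply/funext => j'; rewrite /w invr_expz.
  move=> /le_trans; apply; rewrite lef_pV2 ?posrE //; apply: B_le => /=.
  exact: leq_addr.
have lt_ik : (n.+1 < n.+2 - i + i)%N by lia.
rewrite /succ_min (inf_min r'P) ?(inf_min rP) ?mulVf ?gt_eqF //.
- move=> x xP; have := succ_radii_pairing lt_ik xP r'P.
  by rewrite ler_pdivlMr // mul1r.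
- move=> x xP; have := succ_radii_pairing lt_ik rP xP.
  by rewrite mulrC -ler_pdivrMr // mul1r.
Qed.

End Extension.

Theorem theorem3p3 (R : realType) (F : finFieldType) (l n : nat)
    (hl : (0 < l)%N)
    (L : fieldExtType (laurent F)) (t : L)
    (ht : t ^+ l = (lpoly ('X : {poly F}))%:A)
    (hL : <<1; t>>%VS = fullv)
    (absL : L -> R) (habs : extends_labs absL)
    (a : 'I_n.+1 -> int) (Lam : set 'cV[laurent F]_n.+1)
    (hLam : is_lattice Lam) :
  let q : R := #|F|%:R in
  let g : 'M[L]_n.+1 := diag_mx (\row_j t ^ a j) in
  let gs : 'M[L]_n.+1 := invmx g^T in
  forall i : nat, (1 <= i <= n.+1)%N ->
    q `^ (- ((l%:R - 1) / l%:R))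
      <= succ_min absL (mx_lattice gs (dual_lattice Lam)) i
         * succ_min absL (mx_lattice g Lam) (n.+2 - i)
      <= q `^ ((l%:R - 1) / l%:R).
Proof.
move=> q g gs i hi; rewrite (succ_min_dual habs ht a hLam hi).
have e_ge0 : 0 <= (l%:R - 1) / l%:R :> R.
  by rewrite divr_ge0 // subr_ge0 ler1n.
have q_gt1 : 1 < q := card_gt1 R F.
rewrite powRN invf_le1 ?powR_gt0 ?(lt_trans _ q_gt1) // andbb.
have := ler_powR (ltW q_gt1) e_ge0; by rewrite powRr0.
Qed.
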